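(* For every $i\in\{1,3,4,5,6\}$, the class of 3-frames satisfying (B$i$) is not $\mathcal L_\beta$-definable. Moreover, the class of 3-frames satisfying (B8) is not $\mathcal H_\beta(@)$-definable.
   Context: A 3-frame is $\langle W,B\rangle$ with $B\subseteq W^3$; $\#(x,y,z)$ means $x,y,z$ pairwise distinct. The conditions (universally closed): (B1) $B(x,y,z)\to\#(x,y,z)$; (B3) $B(x,y,z)\to\neg B(x,z,y)$; (B4) $B(x,y,z)\wedge B(y,z,u)\to B(x,y,u)$; (B5) $B(x,y,z)\wedge B(y,u,z)\to B(x,y,u)$; (B6) $\#(x,y,z)\to B(x,y,z)\vee B(x,z,y)\vee B(y,x,z)$; (B8) $x\neq z\to\exists y\,B(x,y,z)$. $\mathcal L_\beta$: $\varphi::=\top\mid p\mid\neg\varphi\mid\varphi\wedge\psi\mid\langle B\rangle(\varphi,\psi)$; $\mathcal H_\beta(@)$ additionally has nominals $i$ and $@_i\varphi$. Valuations map variables to subsets and nominals to singletons; $w\Vdash\langle B\rangle(\varphi,\psi)$ iff there are $x,y$ with $x\Vdash\varphi$, $y\Vdash\psi$ and $B(x,w,y)$; $w\Vdash i$ iff $V(i)=\{w\}$; $w\Vdash @_i\varphi$ iff the element of $V(i)$ satisfies $\varphi$. A class $K$ of 3-frames is $\mathcal L$-definable if there is a set $\Phi$ of $\mathcal L$-formulas such that for every 3-frame $\mathfrak F$, $\mathfrak F\in K$ iff all formulas of $\Phi$ are valid on $\mathfrak F$. *)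

(* Defs.v *)
From mathcomp Require Import all_boot.
From mathcomp Require Import classical_sets.

Set Implicit Arguments.
Unset Strict Implicit.
Unset Printing Implicit Defensive.

Record frame3 : Type := Frame3 {
  world : Type;
  btw : world -> world -> world -> Prop }.

Definition distinct3 (T : Type) (x y z : T) : Prop :=
  [/\ x <> y, y <> z & x <> z].

Definition condB1 (F : frame3) : Prop :=
  forall x y z : world F, btw x y z -> distinct3 x y z.

Definition condB3 (F : frame3) : Prop :=
  forall x y z : world F, btw x y z -> ~ btw x z y.

Definition condB4 (F : frame3) : Prop :=
  forall x y z u : world F, btw x y z /\ btw y z u -> btw x y u.

Definition condB5 (F : frame3) : Prop :=
  forall x y z u : world F, btw x y z /\ btw y u z -> btw x y u.

Definition condB6 (F : frame3) : Prop :=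
  forall x y z : world F,
    distinct3 x y z -> btw x y z \/ btw x z y \/ btw y x z.

Definition condB8 (F : frame3) : Prop :=
  forall x z : world F, x <> z -> exists y, btw x y z.

(* In both languages the set PV of propositional variables and the set NV of
   nominals are arbitrary. *)

Inductive lform (PV : Type) : Type :=
| LTop
| LVar of PV
| LNeg of lform PV
| LAnd of lform PV & lform PV
| LDia of lform PV & lform PV.

Inductive hform (PV NV : Type) : Type :=
| HTop
| HVar of PV
| HNom of NV
| HNeg of hform PV NV
| HAnd of hform PV NV & hform PV NV
| HDia of hform PV NV & hform PV NV
| HAt of NV & hform PV NV.

Fixpoint lsat (PV : Type) (F : frame3) (V : PV -> set (world F))
    (w : world F) (phi : lform PV) : Prop :=
  match phi with
  | LTop => True
  | LVar p => V p w
  | LNeg a => ~ lsat V w a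
  | LAnd a b => lsat V w a /\ lsat V w b
  | LDia a b => exists x y, [/\ lsat V x a, lsat V y b & btw x w y]
  end.

Record hval (PV NV : Type) (F : frame3) : Type := HVal {
  hvar : PV -> set (world F);
  hnom : NV -> set (world F);
  hnom_singleton : forall i, exists w, hnom i = [set w]%classic }.

Fixpoint hsat (PV NV : Type) (F : frame3) (V : hval PV NV F)
    (w : world F) (phi : hform PV NV) : Prop :=
  match phi with
  | HTop => True
  | HVar p => hvar V p w
  | HNom i => hnom V i = [set w]%classic
  | HNeg a => ~ hsat V w a
  | HAnd a b => hsat V w a /\ hsat V w b
  | HDia a b => exists x y, [/\ hsat V x a, hsat V y b & btw x w y]
  | HAt i a => exists2 u, hnom V i = [set u]%classic & hsat V u a
  end.

Definition lvalid (PV : Type) (F : frame3) (phi : lform PV) : Prop :=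
  forall (V : PV -> set (world F)) (w : world F), lsat V w phi.

Definition hvalid (PV NV : Type) (F : frame3) (phi : hform PV NV) : Prop :=
  forall (V : hval PV NV F) (w : world F), hsat V w phi.

Definition Lbeta_definable (PV : Type) (K : frame3 -> Prop) : Prop :=
  exists Phi : set (lform PV),
    forall F : frame3, K F <-> (forall phi, Phi phi -> lvalid F phi).

Definition Hbeta_definable (PV NV : Type) (K : frame3 -> Prop) : Prop :=
  exists Phi : set (hform PV NV),
    forall F : frame3, K F <-> (forall phi, Phi phi -> hvalid F phi).

(* Main.v *)
Require Import Defs.
From mathcomp Require Import all_boot.
From mathcomp Require Import classical_sets.

Set Implicit Arguments.
Unset Strict Implicit.
Unset Printing Implicit Defensive.

(** Validity of [Lbeta]-formulas passes from a frame to any frame covered by its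
    bounded morphic images, and validity of [Hbeta(@)]-formulas passes from a
    frame to its generated subframes, i.e. the subsets containing both
    neighbours of each of their points.  None of the conditions is stable
    under the corresponding construction.  For (B1)-(B6) it is enough to use
    frames in which every point lies between exactly one pair of points. *)

Definition bounded_morphism (F G : frame3) (f : world F -> world G) : Prop :=
  (forall x y z, btw x y z -> btw (f x) (f y) (f z)) /\
  (forall w u v, btw u (f w) v ->
     exists x y, [/\ f x = u, f y = v & btw x w y]).

Lemma lsat_bounded_morphism (PV : Type) (F G : frame3)
    (f : world F -> world G) (V : PV -> set (world G)) (w : world F)
    (phi : lform PV) :
  bounded_morphism f ->
  lsat (fun p => f @^-1` V p)%classic w phi <-> lsat V (f w) phi.
Proof.
move=> [forth back]; elim: phi w => //= [a IHa|a IHa b IHb|a IHa b IHb] w.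
- by rewrite IHa.
- by rewrite IHa IHb.
split=> [[x [y [/IHa Hx /IHb Hy Hxy]]]|[u [v [Hu Hv /back]]]].
  by exists (f x), (f y); split=> //; exact: forth.
move=> [x [y [Ex Ey Hxy]]]; exists x, y; split=> //.
  by apply/IHa; rewrite Ex.
by apply/IHb; rewrite Ey.
Qed.

(** A valuation on [G] pulls back along [f]. Since [f] may depend on [g], this covers both
    surjective bounded morphisms and disjoint unions of copies of [F]. *)
Lemma Lbeta_definable_image (PV : Type) (K : frame3 -> Prop) (F G : frame3) :
  Lbeta_definable PV K -> K F ->
  (forall g : world G,
     exists f : world F -> world G, bounded_morphism f /\ exists w, f w = g) ->
  K G.
Proof.
move=> [Phi defK] /defK validF cover; apply/defK => phi Hphi V g.
have [f [bf [w <-]]] := cover g.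
by apply/(lsat_bounded_morphism _ _ _ bf); exact: validF.
Qed.

Lemma singleton_inj (T : Type) (x y : T) :
  ([set x] = [set y])%classic -> x = y.
Proof. by move=> E; have : [set y]%classic x by rewrite -E. Qed.

(** The valuation is pushed forward, because the preimage of a nominal's singleton may be empty.
    Injectivity ensures that [f w] lies in the image of a set only if [w] lies in the set. *)
Lemma hsat_bounded_morphism (PV NV : Type) (F G : frame3)
    (f : world F -> world G) (V : hval PV NV F) (V' : hval PV NV G) :
  bounded_morphism f -> injective f ->
  (forall p, hvar V' p = f @` hvar V p)%classic ->
  (forall i, hnom V' i = f @` hnom V i)%classic ->
  forall (w : world F) (phi : hform PV NV),
    hsat V' (f w) phi <-> hsat V w phi.
Proof.
move=> [forth back] inj_f Vvar Vnom w phi; elim: phi w => //=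
  [p|i|a IHa|a IHa b IHb|a IHa b IHb|i a IHa] w.
- rewrite Vvar; split=> [[x Vx fxw]|Vw]; last by exists w.
  by rewrite -(inj_f _ _ fxw).
- have [v Ev] := hnom_singleton V i.
  rewrite Vnom Ev image_set1; split=> [fvw|vw].
    by rewrite (inj_f _ _ (singleton_inj fvw)).
  by rewrite (singleton_inj vw).
- by rewrite IHa.
- by rewrite IHa IHb.
- split=> [[u [v [Hu Hv /back]]]|[x [y [/IHa Hx /IHb Hy Hxy]]]].
    move=> [x [y [Ex Ey Hxy]]]; exists x, y; split=> //.
      by apply/IHa; rewrite Ex.
    by apply/IHb; rewrite Ey.
  by exists (f x), (f y); split=> //; exact: forth.
- have [v Ev] := hnom_singleton V i.
  rewrite Vnom Ev image_set1; split=> [[u fvu]|[u vu Ha]].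
    by rewrite -(singleton_inj fvu) => /IHa; exists v.
  by exists (f v) => //; apply/IHa; rewrite (singleton_inj vu).
Qed.

Lemma Hbeta_definable_subframe (PV NV : Type) (K : frame3 -> Prop)
    (F G : frame3) (f : world G -> world F) :
  Hbeta_definable PV NV K -> bounded_morphism f -> injective f -> K F -> K G.
Proof.
move=> [Phi defK] bf inj_f /defK validF; apply/defK => phi Hphi V w.
have nom1 i : exists u, (f @` hnom V i = [set u])%classic.
  by have [v ->] := hnom_singleton V i; exists (f v); rewrite image_set1.
pose V' := HVal (fun p => f @` hvar V p)%classic nom1.
by apply/(@hsat_bounded_morphism _ _ _ _ f V V') => //; exact: validF.
Qed.

Definition fun_frame (T : Type) (l r : T -> T) : frame3 :=
  @Frame3 T (fun x y z => x = l y /\ z = r y).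

(** As neighbours are unique, forth and back both reduce to commutation with the neighbour maps. *)
Lemma fun_frame_bounded_morphism (T T' : Type) (l r : T -> T)
    (l' r' : T' -> T') (f : T -> T') :
  (forall w, f (l w) = l' (f w)) -> (forall w, f (r w) = r' (f w)) ->
  @bounded_morphism (fun_frame l r) (fun_frame l' r') f.
Proof.
move=> fl fr; split=> [_ y _ [-> ->]|w _ _ [-> ->]]; first by split.
by exists (l w), (r w).
Qed.

Lemma Lbeta_definable_fun_frame (PV : Type) (K : frame3 -> Prop)
    (T T' : Type) (l r : T -> T) (l' r' : T' -> T') :
  Lbeta_definable PV K -> K (fun_frame l r) ->
  (forall g, exists f : T -> T',
     [/\ forall w, f (l w) = l' (f w), forall w, f (r w) = r' (f w)
       & exists w, f w = g]) ->
  K (fun_frame l' r').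
Proof.
move=> defK KF cover; apply: (Lbeta_definable_image defK KF) => g.
have [f [fl fr fw]] := cover g.
by exists f; split=> //; exact: fun_frame_bounded_morphism.
Qed.

Lemma condB1_not_Lbeta_definable (PV : Type) : ~ Lbeta_definable PV condB1.
Proof.
(* Flipping different coordinates keeps [l w], [w] and [r w] pairwise distinct; the map to [unit]
   merges them. *)
pose l (w : bool * bool) := (~~ w.1, w.2).
pose r (w : bool * bool) := (w.1, ~~ w.2).
move=> defK; suff KG : condB1 (@fun_frame unit id id) by case: (KG tt tt tt).
apply: (Lbeta_definable_fun_frame (l := l) (r := r) defK).
  by move=> _ [[] []] _ [-> ->].
by case; exists (fun=> tt); split=> //; exists (true, true).
Qed.

Lemma condB3_not_Lbeta_definable (PV : Type) : ~ Lbeta_definable PV condB3.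
Proof.
pose l (w : bool * bool) := (~~ w.1, w.2).
pose r (w : bool * bool) := (w.1, ~~ w.2).
move=> defK; suff KG : condB3 (@fun_frame unit id id) by case: (KG tt tt tt).
apply: (Lbeta_definable_fun_frame (l := l) (r := r) defK).
  (* A common left neighbour of [y] and [z] forces [y = z], as [l] is injective, but [z = r y]
     differs from [y]. *)
  by move=> _ [[] []] _ [-> ->] [].
by case; exists (fun=> tt); split=> //; exists (true, true).
Qed.

Lemma condB4_not_Lbeta_definable (PV : Type) : ~ Lbeta_definable PV condB4.
Proof.
(* The premises of (B4) would give [y = l (r y)], but [l (r y)] flips the second coordinate of [y],
   so (B4) holds vacuously. Forgetting that coordinate makes the premises satisfiable. *)
pose l (w : bool * bool) := (~~ w.1, ~~ w.2).
pose r (w : bool * bool) := (~~ w.1, w.2).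
move=> defK.
suff KG : condB4 (fun_frame negb negb) by case: (KG true false true false).
apply: (Lbeta_definable_fun_frame (l := l) (r := r) defK).
  by move=> x [[] []] z u [[-> ->] []].
by move=> g; exists fst; split=> //; exists (g, true).
Qed.

Lemma condB5_not_Lbeta_definable (PV : Type) : ~ Lbeta_definable PV condB5.
Proof.
(* The premises of (B5) give [r y = r u], hence equal second coordinates, while [y = l u] makes them
   differ. Again [fst] erases this obstruction. *)
pose l (w : bool * bool) := (true, ~~ w.2).
pose r (w : bool * bool) := (true, w.2).
move=> defK.
suff KG : condB5 (fun_frame xpredT xpredT).
  by case: (KG true true true false).
apply: (Lbeta_definable_fun_frame (l := l) (r := r) defK).
  by move=> x y z [[] []] [[-> ->] [-> ]].
by move=> g; exists fst; split=> //; exists (g, true).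
Qed.

(* A disjoint union of reflexive points is covered by copies of one of them. *)
Lemma condB6_not_Lbeta_definable (PV : Type) : ~ Lbeta_definable PV condB6.
Proof.
move=> defK.
suff KG : condB6 (@fun_frame (option bool) id id).
  by case: (KG None (Some true) (Some false)) => [|[]|[[]|[]]].
apply: (Lbeta_definable_fun_frame (l := id) (r := id) (T := unit) defK).
  by move=> [] [] [] [].
by move=> g; exists (fun=> g); split=> //; exists tt.
Qed.

(* [None] lies between any two points, and no other point lies between any
   two, so the points [Some b] form a generated subframe without betweenness. *)
Lemma condB8_not_Hbeta_definable (PV NV : Type) :
  ~ Hbeta_definable PV NV condB8.
Proof.
pose F := @Frame3 (option bool) (fun _ y _ => y = None).
pose G := @Frame3 bool (fun _ _ _ => False).
move=> defK.
have bf : @bounded_morphism G F Some by split.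
have /(Hbeta_definable_subframe defK bf Some_inj) : condB8 F.
  by move=> x z _; exists None.
by move=> /(_ true false) [].
Qed.

Theorem theorem4p15 (PV NV : Type) :
  (~ Lbeta_definable PV condB1 /\
   ~ Lbeta_definable PV condB3 /\
   ~ Lbeta_definable PV condB4 /\
   ~ Lbeta_definable PV condB5 /\
   ~ Lbeta_definable PV condB6) /\
  ~ Hbeta_definable PV NV condB8.
Proof.
split; last exact: condB8_not_Hbeta_definable.
split; first exact: condB1_not_Lbeta_definable.
split; first exact: condB3_not_Lbeta_definable.
split; first exact: condB4_not_Lbeta_definable.
split; first exact: condB5_not_Lbeta_definable.
exact: condB6_not_Lbeta_definable.
Qed.
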